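(* Suppose that $\mathcal S$ is a class of ordered structures such that (1) $\mathcal S$ has the superamalgamation property, and (2) every structure $\mathbf F\in\mathcal S$ can be extended to some structure $\mathbf E\in\mathcal S$ such that every subset of $F$ has both a meet and a join in $\mathbf E$ (in particular, this applies if every structure $\mathbf F$ in $\mathcal S$ can be embedded into some structure $\mathbf E\in\mathcal S$ such that the order on $\mathbf E$ is a complete bounded lattice). If $\mathcal S_1$ is the class of expansions of structures of $\mathcal S$ obtained by adding a new operation satisfying some fixed property chosen from (A1e)–(C2) in the list given in the context, then $\mathcal S_1$ has the superamalgamation property, in particular, the strong amalgamation property. In particular, this applies to adding an isotone, or an extensive, idempotent, closure, interior, or antitone operation. More generally, the same applies to expansions obtained by adding families of such operations, possibly with comparability conditions among operations satisfying the same property.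
   Context: Ordered structures are posets with possibly additional operations and relations, viewed as models in the sense of classical model theory; if there are several partial orders, one specific order $\le$ is selected and the superamalgamation property refers to it. Classes of structures consist of structures of the same type and are closed under isomorphism. Embeddings are required to be at least order-embeddings; an embedding for $\mathcal S_1$ is an embedding for $\mathcal S$ which in addition respects the new operations. $\mathbf A\subseteq\mathbf B$ ($\mathbf A$ is a substructure of $\mathbf B$, $\mathbf B$ extends $\mathbf A$) means that $A\subseteq B$ and the inclusion is an embedding. A class $\mathcal S$ has the strong amalgamation property if, whenever $\mathbf A,\mathbf B,\mathbf C\in\mathcal S$, $\mathbf C\subseteq\mathbf A$, $\mathbf C\subseteq\mathbf B$ and $C=A\cap B$, there is $\mathbf D\in\mathcal S$ such that $\mathbf A\subseteq\mathbf D$ and $\mathbf B\subseteq\mathbf D$. It has the superamalgamation property if, whenever $\mathbf A,\mathbf B,\mathbf C\in\mathcal S$, $\mathbf C\subseteq\mathbf A$, $\mathbf C\subseteq\mathbf B$ and $C=A\cap B$, there is $\mathbf D\in\mathcal S$ such that $\mathbf A\subseteq\mathbf D$ and $\mathbf B\subseteq\mathbf D$, with the additional property that, for every $a\in A\setminus B$ and $b\in B\setminus A$: (a) if $a\le_{\mathbf D}b$, then there is $c\in C$ such that $a\le_{\mathbf A}c$ and $c\le_{\mathbf B}b$; (b) if $b\le_{\mathbf D}a$, then there is $c\in C$ such that $b\le_{\mathbf B}c$ and $c\le_{\mathbf A}a$. Properties of an operation on an ordered structure. For a unary operation $K$: (A1e) extensive ($x\le Kx$ for all $x$); (A1c) contractive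 ($Kx\le x$ for all $x$); (A2) idempotent ($KKx=Kx$ for all $x$); (A2e) idempotent and extensive; (A2c) idempotent and contractive; (A3) involutive ($KKx=x$ for all $x$); (B1) isotone ($x\le y$ implies $Kx\le Ky$); (B1e) isotone and extensive; (B1c) isotone and contractive; (B2) isotone and idempotent; (B3) a closure operation (isotone, extensive and idempotent); (B4) an interior operation (isotone, contractive and idempotent); (B5) antitone ($x\le y$ implies $Ky\le Kx$). For an $n$-ary operation $F$ ($n\ge 1$, $i,j\ge 0$, $i+j\le n$): (C1)$_{i,j,n}$ $F$ is isotone on the first $i$ components and antitone on the last $j$ components (each component being varied with the other arguments fixed); (C2)$_{i,j,n,h}$ $F$ satisfies (C1)$_{i,j,n}$ and moreover $x_1\le F\bar x,\dots,x_h\le F\bar x$ for all $\bar x$, where $h\le i$ is fixed. No additivity or multiplicativity is assumed for closure and interior operations. A comparability condition between two operations $H,K$ of the same arity is a condition of the form ''$H\bar x\le K\bar x$ for every $\bar x$''. ''Complete'' is meant in the lattice-theoretical sense. *)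

(* Defs.v *)
From HB Require Import structures.
From mathcomp Require Import all_boot all_order.
From mathcomp Require Import classical_sets.

Set Implicit Arguments.
Unset Strict Implicit.
Unset Printing Implicit Defensive.

Import Order.Theory.
Local Open Scope classical_set_scope.
Local Open Scope order_scope.

(* The selected order is not a symbol of the signature: it is the order of the
   carrier. Constants are operations of arity 0; any further partial orders are
   among the relations. *)
Record signature := Signature {
  op_symbol : Type;
  op_arity : op_symbol -> nat;
  rel_symbol : Type;
  rel_arity : rel_symbol -> nat
}.

Record ordered_structure (d : Order.disp_t) (L : signature) := OrderedStructure {
  carrier :> porderType d;
  op : forall s : op_symbol L, ('I_(op_arity s) -> carrier) -> carrier;
  rel : forall r : rel_symbol L, ('I_(rel_arity r) -> carrier) -> Prop
}.

Section Amalgamation.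
Variables (d : Order.disp_t) (L : signature).
Implicit Types A B C D : ordered_structure d L.
Implicit Type S : ordered_structure d L -> Prop.

(* Injectivity follows from the first clause by antisymmetry. *)
Definition embedding A B (f : A -> B) : Prop :=
  [/\ {mono f : x y / x <= y},
      forall (s : op_symbol L) (x : 'I_(op_arity s) -> A),
        f (op x) = op (f \o x)
    & forall (r : rel_symbol L) (x : 'I_(rel_arity r) -> A),
        rel x <-> rel (f \o x)].

Definition isomorphism_closed S : Prop :=
  forall A B (f : A -> B), embedding f -> bijective f -> S A -> S B.

(* The inclusions of C in A and B and of A and B in D are rendered by
   embeddings; then "C is the intersection of A and B" says that the images of
   A and B in D meet exactly in the image of C. *)
Definition strong_amalgam A B C D (f : C -> A) (g : C -> B)
    (i : A -> D) (j : B -> D) : Prop :=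
  [/\ embedding i, embedding j, i \o f =1 j \o g
    & (range i `&` range j = range (i \o f))%classic].

Definition strong_amalgamation S : Prop :=
  forall A B C (f : C -> A) (g : C -> B),
    S A -> S B -> S C -> embedding f -> embedding g ->
    exists D (i : A -> D) (j : B -> D), S D /\ strong_amalgam f g i j.

Definition superamalgamation S : Prop :=
  forall A B C (f : C -> A) (g : C -> B),
    S A -> S B -> S C -> embedding f -> embedding g ->
    exists D (i : A -> D) (j : B -> D),
      [/\ S D, strong_amalgam f g i j
        & forall (a : A) (b : B), ~ range f a -> ~ range g b ->
            (i a <= j b -> exists c : C, a <= f c /\ g c <= b) /\
            (j b <= i a -> exists c : C, b <= g c /\ f c <= a)].

Definition meet_join_extendible S : Prop :=
  forall F : ordered_structure d L, S F ->
    exists (E : ordered_structure d L) (e : F -> E),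
      [/\ S E, embedding e
        & forall X : set F, infimums (e @` X) !=set0 /\
                            supremums (e @` X) !=set0].

(* Such a poset is bounded: take X empty. *)
Definition complete_lattice (T : porderType d) : Prop :=
  forall X : set T, infimums X !=set0 /\ supremums X !=set0.

Definition completely_extendible S : Prop :=
  forall F : ordered_structure d L, S F ->
    exists (E : ordered_structure d L) (e : F -> E),
      [/\ S E, embedding e & complete_lattice E].

End Amalgamation.

Inductive op_property : Type :=
| A1e | A1c | A2 | A2e | A2c | A3
| B1 | B1e | B1c | B2 | B3 | B4 | B5
| C1 (i j n : nat) of (0 < n)%N & (i + j <= n)%N
| C2 (i j n h : nat) of (0 < n)%N & (i + j <= n)%N & (h <= i)%N.

Definition property_arity (p : op_property) : nat :=
  match p with
  | C1 _ _ n _ _ => n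
  | C2 _ _ n _ _ _ _ => n
  | _ => 1
  end.

Section Properties.
Variables (d : Order.disp_t) (T : porderType d).
Implicit Type K : T -> T.

Definition extensive K : Prop := forall x, x <= K x.
Definition contractive K : Prop := forall x, K x <= x.
Definition isotone K : Prop := {homo K : x y / x <= y}.
Definition antitone K : Prop := {homo K : x y /~ x <= y}.

Definition isotone_at n (F : ('I_n -> T) -> T) (k : 'I_n) : Prop :=
  forall x y : 'I_n -> T,
    (forall l, l != k -> x l = y l) -> x k <= y k -> F x <= F y.

Definition antitone_at n (F : ('I_n -> T) -> T) (k : 'I_n) : Prop :=
  forall x y : 'I_n -> T,
    (forall l, l != k -> x l = y l) -> x k <= y k -> F y <= F x.

Definition isotone_antitone i j n (F : ('I_n -> T) -> T) : Prop :=
  (forall k : 'I_n, (k < i)%N -> isotone_at F k) /\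
  (forall k : 'I_n, (n - j <= k)%N -> antitone_at F k).

Definition unary (F : ('I_1 -> T) -> T) : T -> T := fun x => F (fun=> x).

Definition satisfies (p : op_property) :
    (('I_(property_arity p) -> T) -> T) -> Prop :=
  match p return (('I_(property_arity p) -> T) -> T) -> Prop with
  | A1e => fun F => extensive (unary F)
  | A1c => fun F => contractive (unary F)
  | A2  => fun F => idempotent_fun (unary F)
  | A2e => fun F => idempotent_fun (unary F) /\ extensive (unary F)
  | A2c => fun F => idempotent_fun (unary F) /\ contractive (unary F)
  | A3  => fun F => involutive (unary F)
  | B1  => fun F => isotone (unary F)
  | B1e => fun F => isotone (unary F) /\ extensive (unary F)
  | B1c => fun F => isotone (unary F) /\ contractive (unary F)
  | B2  => fun F => isotone (unary F) /\ idempotent_fun (unary F)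
  | B3  => fun F => [/\ isotone (unary F), extensive (unary F)
                      & idempotent_fun (unary F)]
  | B4  => fun F => [/\ isotone (unary F), contractive (unary F)
                      & idempotent_fun (unary F)]
  | B5  => fun F => antitone (unary F)
  | C1 i j n _ _ => fun F => isotone_antitone i j F
  | C2 i j n h _ _ _ => fun F =>
      isotone_antitone i j F /\
      (forall (k : 'I_n) (x : 'I_n -> T), (k < h)%N -> x k <= F x)
  end.

End Properties.

(* A family of new operation symbols is given by the type I p of those assigned
   to each property p, so symbols with the same property have the same arity
   and can be compared. *)
Definition expand (L : signature) (I : op_property -> Type) : signature :=
  @Signature (op_symbol L + {p : op_property & I p})%type
    (fun s => match s with
              | inl s0 => op_arity s0
              | inr pk => property_arity (projT1 pk)
              end)
    (rel_symbol L) (@rel_arity L).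

Section Expansions.
Variables (d : Order.disp_t) (L : signature) (I : op_property -> Type).

Definition reduct (A : ordered_structure d (expand L I)) :
    ordered_structure d L :=
  @OrderedStructure d L (carrier A)
    (fun s => @op d (expand L I) A (inl s))
    (fun r => @rel d (expand L I) A r).

Definition new_op (A : ordered_structure d (expand L I))
    (p : op_property) (k : I p) : ('I_(property_arity p) -> A) -> A :=
  @op d (expand L I) A (inr (existT I p k)).

(* R p h k imposes the comparability condition h(x) <= k(x) for every x. *)
Definition expansions (S : ordered_structure d L -> Prop)
    (R : forall p, I p -> I p -> Prop) :
    ordered_structure d (expand L I) -> Prop :=
  fun A =>
    [/\ S (reduct A),
        forall p (k : I p), satisfies (@new_op A p k)
      & forall p (h k : I p), R p h k ->
          forall x : 'I_(property_arity p) -> A, new_op h x <= new_op k x].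

End Expansions.

(* The family consisting of a single symbol, assigned to the property p. *)
Inductive sole (p : op_property) : op_property -> Type := Sole : sole p p.

Definition no_comparability (I : op_property -> Type) :
    forall p, I p -> I p -> Prop := fun _ _ _ => False.

(* Main.v *)
Require Import Defs.
From mathcomp Require Import all_boot all_order.
From mathcomp Require Import classical_sets.
From mathcomp Require Import boolp.

Set Implicit Arguments.
Unset Strict Implicit.
Unset Printing Implicit Defensive.

Import Order.Theory.
Local Open Scope classical_set_scope.
Local Open Scope order_scope.

(** The reducts of A, B and C are amalgamated first: superamalgamation in S gives
    a structure D, and D extends to a structure E of S in which every subset of D
    has a meet and a join. Write A and B again for their copies in E. Each new
    operation is then prescribed on the tuples lying wholly in A or wholly in B,
    and everything comes down to extending these partial operations to the whole
    of E, by a recipe that depends on the property alone and is increasing in the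
    prescribed values, so that comparability conditions carry over. Since D is embedded in E, the interpolation clause of
    superamalgamation also holds for the order of E.

    Why the prescribed partial operation behaves well. All isotony and antitony
    requirements say that F is increasing for the order [signed_le] on tuples, in
    which some components are reversed and some must agree. Suppose that a tuple
    of A lies below a tuple of B in this order. Superamalgamation interpolates
    each component by an element of C, hence the value computed in A lies below a
    value computed in C, which lies below the value computed in B
    ([signed_homo_across]). So the union of the operations of A and B is well
    defined and increasing ([glued_homo]).

    How it extends.
    - When no monotonicity is required, the operation acts as the identity outside
      A and B (this is built into [glue]).
    - For isotone, isotone extensive, closure, antitone and mixed operations, F x
      is the meet of the prescribed values at the tuples above x ([upper_ext]).
      Where F is to be extensive, the relevant entries of x lie below those of
      each such tuple, hence below each of these values, hence below the meet.
      For isotone contractive and interior operations the dual recipe is used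
      ([lower_ext]).
    - For isotone idempotent operations neither recipe need be idempotent. They are
      combined: the join L x of the prescribed values below x is followed by the
      closure operator whose closed elements are the meets of prescribed fixed
      points ([idem_ext]). *)

(** * Isotony and antitony as monotonicity for one order on tuples *)

Lemma tuple1E (T : Type) (x : 'I_1 -> T) : x = (fun=> x ord0).
Proof. by apply: funext => k; rewrite (ord1 k). Qed.

Section SignedOrder.
Variables (d : Order.disp_t) (T : porderType d).

Definition signed_le p q n (x y : 'I_n -> T) : Prop :=
  forall k : 'I_n, if (k < p)%N then x k <= y k
                   else if (n - q <= k)%N then y k <= x k else x k == y k.

Definition signed_homo p q n (F : ('I_n -> T) -> T) : Prop :=
  forall x y, signed_le p q x y -> F x <= F y.

Lemma signed_le_refl p q n (x : 'I_n -> T) : signed_le p q x x.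
Proof. by move=> k; case: ifP => // _; case: ifP. Qed.

Lemma signed_le_trans p q n (y x z : 'I_n -> T) :
  signed_le p q x y -> signed_le p q y z -> signed_le p q x z.
Proof.
move=> xy yz k; move: (xy k) (yz k); case: ifP => _; first exact: le_trans.
by case: ifP => _ => [yx zy|/eqP -> //]; apply: le_trans zy yx.
Qed.

(** From left to right the components are changed one at a time: [z m] agrees with
    the larger tuple on the first [m] components. A component that is neither
    isotone nor antitone does not change, since [signed_le] makes it equal. *)
Lemma isotone_antitoneP p q n (F : ('I_n -> T) -> T) : (p + q <= n)%N ->
  isotone_antitone p q F <-> signed_homo p q F.
Proof.
move=> pqn; split=> [[isoF antF] x y xy|homoF]; last first.
  split=> k lek x y xy xyk; apply: homoF => l; have [->|nlk] := eqVneq l k.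
  - by rewrite lek.
  - by rewrite (xy _ nlk) !lexx; do !case: ifP => //.
    (* p + q <= n keeps the reversed components disjoint from the first p *)
  - rewrite lek ifN // -leqNgt; apply: leq_trans lek.
    by rewrite leq_subRL ?(leq_trans (leq_addl _ _) pqn) // addnC.
  - by rewrite (xy _ nlk) !lexx; do !case: ifP => //.
pose z m (k : 'I_n) := if (k < m)%N then y k else x k.
have z0 : z 0 = x by apply: funext => k.
have zn : z n = y by apply: funext => k; rewrite /z ltn_ord.
rewrite -z0 -zn; elim: {-2}n (leqnn n) => // m IHm ltmn.
apply: le_trans (IHm (ltnW ltmn)) _.
pose k0 := Ordinal ltmn.
have z_ne l : l != k0 -> z m l = z m.+1 l.
  move=> nl; have nlm : (l == m :> nat) = false by apply: negPf nl.
  by rewrite /z ltnS (leq_eqVlt l m) nlm.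
have zm : z m k0 = x k0 by rewrite /z ltnn.
have zm1 : z m.+1 k0 = y k0 by rewrite /z ltnSn.
move: (xy k0); case: ifP => [lemp xyk|_].
  by apply: (isoF k0) => //; rewrite zm zm1.
case: ifP => [leqm yxk|_ /eqP xyk].
  by apply: (antF k0) => //[l /z_ne ->//|]; rewrite zm zm1.
suff -> : z m.+1 = z m by [].
apply: funext => l; have [->|/z_ne //] := eqVneq l k0.
by rewrite zm zm1.
Qed.

Lemma signed_le1P (y z : T) :
  signed_le 1 0 (fun _ : 'I_1 => y) (fun=> z) <-> y <= z.
Proof. by split=> [/(_ ord0)|yz k] //=; rewrite (ord1 k). Qed.

Lemma isotoneP (F : ('I_1 -> T) -> T) :
  isotone (unary F) <-> signed_homo 1 0 F.
Proof.
split=> [isoF x y /(_ ord0) /= xy|homoF x y xy].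
  by rewrite (tuple1E x) (tuple1E y); apply: isoF.
by apply: homoF; apply/signed_le1P.
Qed.

Lemma antitoneP (F : ('I_1 -> T) -> T) :
  antitone (unary F) <-> signed_homo 0 1 F.
Proof.
split=> [isoF x y /(_ ord0) /= xy|homoF x y xy].
  by rewrite (tuple1E x) (tuple1E y); apply: isoF.
by apply: homoF => k; rewrite (ord1 k).
Qed.

End SignedOrder.

(** * Extension by meets and by joins *)

Section UpperExtension.
Variables (d : Order.disp_t) (E : porderType d) (U : set E) (inf : set E -> E).
Hypothesis inf_spec : forall V : set E, V `<=` U -> infimums V (inf V).
Variables (T : Type) (le : T -> T -> Prop).

(** For a preorder [le], the largest increasing map lying below [G] on [X]. *)
Definition upper_ext (X : set T) (G : T -> E) (x : T) : E :=
  inf (G @` [set u | X u /\ le x u]).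

Variables (X : set T) (G : T -> E).
Hypothesis GU : forall u, X u -> U (G u).

Let ext_spec x : infimums (G @` [set u | X u /\ le x u]) (upper_ext X G x).
Proof. by apply: inf_spec => _ [u [Xu _] <-]; apply: GU. Qed.

Lemma upper_ext_le x u : X u -> le x u -> upper_ext X G x <= G u.
Proof. by move=> Xu xu; apply: (proj1 (ext_spec x)); exists u. Qed.

Lemma upper_ext_ge x y :
  (forall u, X u -> le x u -> y <= G u) -> y <= upper_ext X G x.
Proof.
by move=> yG; apply: (proj2 (ext_spec x)) => _ [u [Xu xu] <-]; apply: yG.
Qed.

Lemma upper_ext_on x : (forall u v, X u -> X v -> le u v -> G u <= G v) ->
  le x x -> X x -> upper_ext X G x = G x.
Proof.
move=> homoG xx Xx; apply: le_anti; rewrite upper_ext_le //=.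
by apply: upper_ext_ge => u Xu; apply: homoG.
Qed.

Lemma upper_ext_homo x y : (forall u, le y u -> le x u) ->
  upper_ext X G x <= upper_ext X G y.
Proof.
by move=> xy; apply: upper_ext_ge => u Xu yu; apply: upper_ext_le => //; apply: xy.
Qed.

(** An extensive extension of an idempotent map is idempotent, because the
    prescribed values that compete in the meet are themselves fixed points: each
    [G u] with [u] above [x] competes again in the meet defining the second
    application. The map [cst] turns a value back into an argument. *)
Lemma upper_ext_idem (cst : E -> T) (x : T) :
  (forall y z, y <= z -> le (cst y) (cst z)) ->
  (forall u, X u -> X (cst (G u))) ->
  (forall u, X u -> G (cst (G u)) = G u) ->
  (forall y, y <= upper_ext X G (cst y)) ->
  upper_ext X G (cst (upper_ext X G x)) = upper_ext X G x.
Proof.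
move=> cst_homo XG GG ext; apply: le_anti; rewrite ext andbT.
apply: upper_ext_ge => u Xu xu; rewrite -[leRHS]GG //.
by apply: upper_ext_le; [exact: XG | apply/cst_homo/upper_ext_le].
Qed.

End UpperExtension.

Section UpperExtensionMono.
Variables (d : Order.disp_t) (E : porderType d) (U : set E) (inf : set E -> E).
Hypothesis inf_spec : forall V : set E, V `<=` U -> infimums V (inf V).
Variables (T : Type) (le : T -> T -> Prop) (X : set T) (G H : T -> E).
Hypotheses (GU : forall u, X u -> U (G u)) (HU : forall u, X u -> U (H u)).

Lemma upper_ext_mono x : (forall u, X u -> G u <= H u) ->
  upper_ext inf le X G x <= upper_ext inf le X H x.
Proof.
move=> GH; apply: (upper_ext_ge inf_spec) => // u Xu xu.
by apply: le_trans (GH _ Xu); apply: (upper_ext_le inf_spec).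
Qed.

End UpperExtensionMono.

(** The dual construction is the same one in the opposite order, so that each fact
    below is the instance at [E^d] of its counterpart. *)
Definition lower_ext d (E : porderType d) (sup : set E -> E) T
    (le : T -> T -> Prop) : set T -> (T -> E) -> T -> E :=
  @upper_ext _ E^d sup T (fun x y => le y x).

Section LowerExtension.
Variables (d : Order.disp_t) (E : porderType d) (U : set E) (sup : set E -> E).
Hypothesis sup_spec : forall V : set E, V `<=` U -> supremums V (sup V).
Variables (T : Type) (le : T -> T -> Prop) (X : set T) (G : T -> E).
Hypothesis GU : forall u, X u -> U (G u).

Lemma lower_ext_ge x u : X u -> le u x -> G u <= lower_ext sup le X G x.
Proof. exact: (@upper_ext_le _ E^d U sup sup_spec). Qed.

Lemma lower_ext_le x y :
  (forall u, X u -> le u x -> G u <= y) -> lower_ext sup le X G x <= y.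
Proof. exact: (@upper_ext_ge _ E^d U sup sup_spec). Qed.

Lemma lower_ext_on x : (forall u v, X u -> X v -> le u v -> G u <= G v) ->
  le x x -> X x -> lower_ext sup le X G x = G x.
Proof.
move=> homoG; apply: (@upper_ext_on _ E^d U sup sup_spec) => // u v Xu Xv.
exact: homoG.
Qed.

Lemma lower_ext_homo x y : (forall u, le u x -> le u y) ->
  lower_ext sup le X G x <= lower_ext sup le X G y.
Proof. exact: (@upper_ext_homo _ E^d U sup sup_spec). Qed.

Lemma lower_ext_idem (cst : E -> T) (x : T) :
  (forall y z, y <= z -> le (cst y) (cst z)) ->
  (forall u, X u -> X (cst (G u))) ->
  (forall u, X u -> G (cst (G u)) = G u) ->
  (forall y, lower_ext sup le X G (cst y) <= y) ->
  lower_ext sup le X G (cst (lower_ext sup le X G x)) = lower_ext sup le X G x.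
Proof.
move=> cst_homo; apply: (@upper_ext_idem _ E^d U sup sup_spec) => // y z.
exact: cst_homo.
Qed.

End LowerExtension.

Lemma lower_ext_mono d (E : porderType d) (U : set E) (sup : set E -> E)
    (sup_spec : forall V : set E, V `<=` U -> supremums V (sup V))
    T (le : T -> T -> Prop) (X : set T) (G H : T -> E) x :
  (forall u, X u -> U (G u)) -> (forall u, X u -> U (H u)) ->
  (forall u, X u -> G u <= H u) ->
  lower_ext sup le X G x <= lower_ext sup le X H x.
Proof.
by move=> GU HU; apply: (@upper_ext_mono _ E^d U sup sup_spec _ _ _ H G).
Qed.

(** * Isotone idempotent operations *)

Section IdempotentExtension.
Variables (d : Order.disp_t) (E : porderType d) (U : set E).
Variables (inf sup : set E -> E).
Hypothesis inf_spec : forall V : set E, V `<=` U -> infimums V (inf V).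
Hypothesis sup_spec : forall V : set E, V `<=` U -> supremums V (sup V).
Variables (T : Type) (le : T -> T -> Prop) (cst : E -> T) (X : set T).

Definition fixed_points (G : T -> E) : set T := [set v | X v /\ v = cst (G v)].

(** The join [lower_ext] alone need not be idempotent: a join of fixed points may
    lie above elements of [X] whose values are not below it. Rounding up to a meet
    of fixed points cures this, by [lower_idem_ext_le] below. *)
Definition idem_ext (G : T -> E) (x : T) : E :=
  upper_ext inf le (fixed_points G) G (cst (lower_ext sup le X G x)).

Hypothesis le_refl : forall x, le x x.
Hypothesis le_trans : forall y x z, le x y -> le y z -> le x z.
Hypothesis cst_le : forall y z, le (cst y) (cst z) <-> y <= z.

Record idempotent_on (G : T -> E) : Prop := IdempotentOn {
  idem_mem : forall u, X u -> U (G u);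
  idem_closed : forall u, X u -> X (cst (G u));
  idem_homo : forall u v, X u -> X v -> le u v -> G u <= G v;
  idem_idem : forall u, X u -> G (cst (G u)) = G u }.

Section One.
Variable G : T -> E.
Hypothesis idG : idempotent_on G.
Let L := lower_ext sup le X G.
Let J := idem_ext G.
Let GU := idem_mem idG.

Let fixU v : fixed_points G v -> U (G v). Proof. by case=> /GU. Qed.

Lemma idem_ext_le x v : X v -> v = cst (G v) -> L x <= G v -> J x <= G v.
Proof.
move=> Xv v_fix Lv; apply: (upper_ext_le inf_spec fixU); first by split.
by rewrite v_fix; apply/cst_le.
Qed.

Lemma idem_ext_ge x y :
  (forall v, X v -> v = cst (G v) -> L x <= G v -> y <= G v) -> y <= J x.
Proof.
move=> yG; apply: (upper_ext_ge inf_spec fixU) => v [Xv v_fix] Lv.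
by apply: yG => //; apply/cst_le; rewrite -v_fix.
Qed.

Lemma lower_le_idem_ext x : L x <= J x.
Proof. exact: idem_ext_ge. Qed.

Lemma idem_ext_on x : X x -> J x = G x.
Proof.
move=> Xx; have Lx : L x = G x.
  by apply: (lower_ext_on sup_spec GU) => //; apply: idem_homo.
have GG := idem_idem idG Xx.
apply: le_anti; rewrite -{2}Lx lower_le_idem_ext andbT -[leRHS]GG.
by apply: idem_ext_le; rewrite ?GG ?Lx //; apply: idem_closed.
Qed.

Lemma idem_ext_homo x y : le x y -> J x <= J y.
Proof.
move=> xy; apply: idem_ext_ge => v Xv v_fix Lyv; apply: idem_ext_le => //.
apply: Order.le_trans Lyv; apply: (lower_ext_homo sup_spec GU) => u ux.
exact: le_trans ux xy.
Qed.

(** Below a meet of fixed points only smaller values are prescribed, because the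
    prescribed operation is increasing and leaves each fixed point in place. *)
Lemma lower_idem_ext_le x : L (cst (J x)) <= J x.
Proof.
apply: (lower_ext_le sup_spec GU) => u Xu uJ; apply: idem_ext_ge => v Xv v_fix Lv.
apply: idem_homo => //; apply: le_trans uJ _; rewrite v_fix; apply/cst_le.
exact: idem_ext_le.
Qed.

(** Each prescribed value competing for [L x] is a fixed point below [J x], so it
    competes for [L (cst (J x))] as well. *)
Lemma lower_le_lower_idem_ext x : L x <= L (cst (J x)).
Proof.
apply: (lower_ext_le sup_spec GU) => u Xu ux; rewrite -(idem_idem idG Xu).
apply: (lower_ext_ge sup_spec GU); first exact: idem_closed.
apply/cst_le/Order.le_trans/lower_le_idem_ext.
exact: (lower_ext_ge sup_spec GU).
Qed.

(** The last two lemmas bracket [L (cst (J x))] between [L x] and [J x], and every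
    prescribed fixed point above the former is above the latter. *)
Lemma idem_ext_idem x : J (cst (J x)) = J x.
Proof.
apply: le_anti; apply/andP; split; apply: idem_ext_ge => v Xv v_fix Lv.
  apply: idem_ext_le => //; apply: Order.le_trans (lower_idem_ext_le x) _.
  exact: idem_ext_le.
apply: idem_ext_le => //; apply: Order.le_trans Lv.
exact: lower_le_lower_idem_ext.
Qed.

End One.

(** For a fixed point [v] of [H] above the lower extension of [H], the value [G v]
    is a fixed point of [G] that lies below [v] and still above the lower extension
    of [G]; so the meet defining the extension of [G] is the smaller one. *)
Lemma idem_ext_mono (G H : T -> E) x :
  idempotent_on G -> idempotent_on H -> (forall u, X u -> G u <= H u) ->
  idem_ext G x <= idem_ext H x.
Proof.
move=> idG idH GH; apply: idem_ext_ge => // v Xv v_fix Lv.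
apply: Order.le_trans (GH _ Xv); rewrite -(idem_idem idG Xv).
apply: idem_ext_le; rewrite ?(idem_idem idG Xv) //; first exact: idem_closed.
apply: (lower_ext_le sup_spec (idem_mem idG)) => u Xu ux.
rewrite -(idem_idem idG Xu); apply: idem_homo => //; first exact: idem_closed.
rewrite v_fix; apply/cst_le; apply: Order.le_trans (GH _ Xu) _.
by apply: Order.le_trans Lv; apply: (lower_ext_ge sup_spec (idem_mem idH)).
Qed.

End IdempotentExtension.

(** * Gluing the operations of the two factors *)

(** Unlike in the superamalgamation property, [a] and [b] may here come from [C];
    an interpolant is then available at once, and the intersection of the images
    of [A] and [B] need not be mentioned any more. *)
Definition interpolating d (A B C E : porderType d) (f : C -> A) (g : C -> B)
    (i : A -> E) (j : B -> E) :=
  forall a b, i a <= j b -> exists c, a <= f c /\ g c <= b.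

(** The heart of the argument. Interpolating every component yields a tuple [c] of
    [C] between [a] and [b]; its value is the same computed in [A], [B] or [C]. *)
Lemma signed_homo_across d (A B C E : porderType d) (f : C -> A) (g : C -> B)
    (i : A -> E) (j : B -> E) p q n
    (FA : ('I_n -> A) -> A) (FB : ('I_n -> B) -> B) (FC : ('I_n -> C) -> C) a b :
  {mono i : x y / x <= y} -> {mono j : x y / x <= y} -> i \o f =1 j \o g ->
  interpolating f g i j -> interpolating g f j i ->
  signed_homo p q FA -> signed_homo p q FB ->
  (forall x, f (FC x) = FA (f \o x)) -> (forall x, g (FC x) = FB (g \o x)) ->
  signed_le p q (i \o a) (j \o b) -> i (FA a) <= j (FB b).
Proof.
move=> imono jmono ifjg itp_ij itp_ji homoA homoB fFC gFC ab.
have /choice [c ac_cb] : forall k : 'I_n, exists c,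
    (if (k < p)%N then a k <= f c
     else if (n - q <= k)%N then f c <= a k else a k == f c) /\
    (if (k < p)%N then g c <= b k
     else if (n - q <= k)%N then b k <= g c else g c == b k).
  move=> k; move: (ab k) => /=; case: ifP => _; first exact: itp_ij.
  case: ifP => _; first by move=> /itp_ji [c []]; exists c.
  (* where the components agree, the interpolant is forced to be their value *)
  move=> /eqP iajb; have /itp_ij [c [ac cb]] : i (a k) <= j (b k) by rewrite iajb.
  have ifc := ifjg c; rewrite /= in ifc.
  exists c; split=> /=; apply/eqP/le_anti/andP; split=> //.
    by rewrite -imono ifc iajb jmono.
  by rewrite -jmono -iajb -ifc imono.
have ac : signed_le p q a (f \o c) by move=> k; case: (ac_cb k).
have cb : signed_le p q (g \o c) b by move=> k; case: (ac_cb k).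
apply: (@le_trans _ _ (i (f (FC c)))).
  by rewrite imono fFC; apply: homoA.
by have /= -> := ifjg (FC c); rewrite jmono gFC; apply: homoB.
Qed.

(** Properties without monotonicity get the counts (0, 0), for which [signed_le] is
    equality; they too can then be glued by [signed_homo_across]. *)
Definition isotone_count (p : op_property) : nat :=
  match p with
  | B1 | B1e | B1c | B2 | B3 | B4 => 1
  | C1 i _ _ _ _ | C2 i _ _ _ _ _ _ => i
  | _ => 0
  end.

Definition antitone_count (p : op_property) : nat :=
  match p with
  | B5 => 1
  | C1 _ j _ _ _ | C2 _ j _ _ _ _ _ => j
  | _ => 0
  end.

Lemma property_arity_gt0 p : (0 < property_arity p)%N.
Proof. by case: p. Qed.

Definition first_arg p : 'I_(property_arity p) :=
  Ordinal (property_arity_gt0 p).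

Lemma satisfies_homo d (T : porderType d) p
    (F : ('I_(property_arity p) -> T) -> T) :
  satisfies F -> signed_homo (isotone_count p) (antitone_count p) F.
Proof.
have homo_eq (G : ('I_1 -> T) -> T) : signed_homo 0 0 G.
  move=> x y xy; rewrite (tuple1E x) (tuple1E y).
  by move: (xy ord0) => /= /eqP ->.
case: p F => [||||||||||||| i j n n0 ijn | i j n h n0 ijn hi] F //=;
  try (by move=> _; apply: homo_eq); try (by case=> /isotoneP);
  try (by move/isotoneP); try (by move/antitoneP).
- by move/(isotone_antitoneP _ ijn).
- by case=> /(isotone_antitoneP _ ijn).
Qed.

Section Glue.
Variables (d : Order.disp_t) (A B C E : porderType d).
Variables (f : C -> A) (g : C -> B) (i : A -> E) (j : B -> E).
Hypotheses (imono : {mono i : x y / x <= y}) (jmono : {mono j : x y / x <= y}).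
Hypothesis ifjg : i \o f =1 j \o g.
Hypotheses (itp_ij : interpolating f g i j) (itp_ji : interpolating g f j i).

Definition glue_domain n : set ('I_n -> E) :=
  [set x | (exists a : 'I_n -> A, x = i \o a) \/
           (exists b : 'I_n -> B, x = j \o b)].

Inductive glued n (FA : ('I_n -> A) -> A) (FB : ('I_n -> B) -> B) :
    ('I_n -> E) -> E -> Prop :=
| GluedLeft a : glued FA FB (i \o a) (i (FA a))
| GluedRight b : glued FA FB (j \o b) (j (FB b)).

(** The default value off the domain makes the operation the identity there when
    it is unary; some default is available since every arity is positive. *)
Definition glue p (FA : ('I_(property_arity p) -> A) -> A)
    (FB : ('I_(property_arity p) -> B) -> B) (x : 'I_(property_arity p) -> E) :=
  xget (x (first_arg p)) [set y | glued FA FB x y].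

Variables (p : op_property) (FA : ('I_(property_arity p) -> A) -> A).
Variables (FB : ('I_(property_arity p) -> B) -> B).
Variables (FC : ('I_(property_arity p) -> C) -> C).
Hypotheses (satA : satisfies FA) (satB : satisfies FB).
Hypotheses (fFC : forall x, f (FC x) = FA (f \o x))
           (gFC : forall x, g (FC x) = FB (g \o x)).

Local Notation le := (signed_le (isotone_count p) (antitone_count p)).

Lemma glued_homo x y u v : glued FA FB x u -> glued FA FB y v -> le x y -> u <= v.
Proof.
have homoA := satisfies_homo satA; have homoB := satisfies_homo satB.
have cancel_i a a' : le (i \o a) (i \o a') -> le a a'.
  move=> aa' k; move: (aa' k) => /=; rewrite !imono.
  by rewrite (inj_eq (inc_inj imono)).
have cancel_j b b' : le (j \o b) (j \o b') -> le b b'.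
  move=> bb' k; move: (bb' k) => /=; rewrite !jmono.
  by rewrite (inj_eq (inc_inj jmono)).
case=> [a|b]; case=> [a'|b'] xy.
- by rewrite imono; apply/homoA/cancel_i.
- exact: (signed_homo_across imono jmono ifjg itp_ij itp_ji homoA homoB fFC gFC).
- apply: (signed_homo_across jmono imono _ itp_ji itp_ij homoB homoA gFC fFC xy).
  by move=> c; rewrite ifjg.
- by rewrite jmono; apply/homoB/cancel_j.
Qed.

(** A tuple may come both from [A] and from [B]. The two values are then equal by
    antisymmetry, since each tuple is related to itself. *)
Lemma glueE x y : glued FA FB x y -> glue FA FB x = y.
Proof.
move=> xy; apply: xget_unique => // z xz.
apply: le_anti; rewrite (glued_homo xz xy) ?(glued_homo xy xz) //;
  exact: signed_le_refl.
Qed.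

Lemma gluedP x : glue_domain x -> glued FA FB x (glue FA FB x).
Proof.
move=> dx; have [y xy] : exists y, glued FA FB x y.
  by case: dx => [[a ->]|[b ->]]; eexists; constructor.
by rewrite (glueE xy).
Qed.

Lemma glue_default x : ~ glue_domain x -> glue FA FB x = x (first_arg p).
Proof.
move=> ndx; apply: xgetPN => y xy; apply: ndx.
by case: xy => [a|b]; [left; exists a | right; exists b].
Qed.

Lemma glue_homo x y : glue_domain x -> glue_domain y -> le x y ->
  glue FA FB x <= glue FA FB y.
Proof. by move=> /gluedP xu /gluedP yv; apply: glued_homo xu yv. Qed.

Lemma glue_range x : glue_domain x ->
  (range i `|` range j) (glue FA FB x).
Proof.
by move=> /gluedP [a|b]; [left; exists (FA a) | right; exists (FB b)].
Qed.

Lemma glue_closed x : glue_domain x ->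
  @glue_domain (property_arity p) (fun=> glue FA FB x).
Proof.
move=> /gluedP [a|b].
  by left; exists (fun=> FA a).
by right; exists (fun=> FB b).
Qed.

Lemma glue_dom_ind (P : ('I_(property_arity p) -> E) -> E -> Prop) :
  (forall a, P (i \o a) (i (FA a))) -> (forall b, P (j \o b) (j (FB b))) ->
  forall x, glue_domain x -> P x (glue FA FB x).
Proof. by move=> PA PB x /gluedP []. Qed.

(** Case analysis on a constant tuple of [E]: it lies in [A], or in [B], or is sent
    to its common entry. *)
Lemma glue_const_ind (P : E -> E -> Prop) :
  (forall a, P (i a) (i (FA (fun=> a)))) ->
  (forall b, P (j b) (j (FB (fun=> b)))) ->
  (forall x, glue FA FB (fun=> x) = x -> P x x) ->
  forall x, P x (glue FA FB (fun=> x)).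
Proof.
move=> PA PB Pid x.
have [[a _ <-]|nA] := pselect (range i x).
  by rewrite (glueE (GluedLeft FA FB (fun=> a))).
have [[b _ <-]|nB] := pselect (range j x).
  by rewrite (glueE (GluedRight FA FB (fun=> b))).
have Gx : glue FA FB (fun=> x) = x.
  rewrite glue_default // => -[[a xa]|[b xb]].
    by apply: nA; have /= -> := congr1 (@^~ (first_arg p)) xa; apply: imageP.
  by apply: nB; have /= -> := congr1 (@^~ (first_arg p)) xb; apply: imageP.
by rewrite Gx; apply: Pid.
Qed.

Lemma glue_idem :
  (forall a, FA (fun=> FA a) = FA a) -> (forall b, FB (fun=> FB b) = FB b) ->
  forall x, glue_domain x ->
    glue FA FB (fun=> glue FA FB x) = glue FA FB x.
Proof.
move=> idemA idemB.
apply: (@glue_dom_ind (fun _ y => glue FA FB (fun=> y) = y)) => [a|b]; apply: glueE.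
  by rewrite -[in X in glued _ _ _ X]idemA; exact: GluedLeft.
by rewrite -[in X in glued _ _ _ X]idemB; exact: GluedRight.
Qed.

End Glue.

Lemma unary_idemP (T : Type) (F : ('I_1 -> T) -> T) :
  idempotent_fun (fun x => F (fun=> x)) -> forall x, F (fun=> F x) = F x.
Proof. by move=> idemF x; rewrite (tuple1E x); apply: idemF. Qed.

(** * The extension attached to each property *)

Definition extend d (E : porderType d) (inf sup : set E -> E) (p : op_property)
    (X : set ('I_(property_arity p) -> E)) (G : ('I_(property_arity p) -> E) -> E)
    : ('I_(property_arity p) -> E) -> E :=
  let le := @signed_le _ E (isotone_count p) (antitone_count p) _ in
  match p with
  | A1e | A1c | A2 | A2e | A2c | A3 => G
  | B2 => idem_ext inf sup le (fun y _ => y) X G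
  | B1c | B4 => lower_ext sup le X G
  | _ => upper_ext inf le X G
  end.

Section ExtendGlue.
Variables (d : Order.disp_t) (A B C E : porderType d).
Variables (f : C -> A) (g : C -> B) (i : A -> E) (j : B -> E).
Hypotheses (imono : {mono i : x y / x <= y}) (jmono : {mono j : x y / x <= y}).
Hypothesis ifjg : i \o f =1 j \o g.
Hypotheses (itp_ij : interpolating f g i j) (itp_ji : interpolating g f j i).
Variables (inf sup : set E -> E).
Hypothesis inf_spec :
  forall V : set E, V `<=` range i `|` range j -> infimums V (inf V).
Hypothesis sup_spec :
  forall V : set E, V `<=` range i `|` range j -> supremums V (sup V).

Definition common_restriction n (FA : ('I_n -> A) -> A) (FB : ('I_n -> B) -> B) :=
  exists FC : ('I_n -> C) -> C,
    (forall x, f (FC x) = FA (f \o x)) /\ (forall x, g (FC x) = FB (g \o x)).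

Local Notation glued_ext FA FB :=
  (extend inf sup (@glue_domain _ A B E i j _) (glue i j FA FB)).

Lemma idempotent_on_glue (FA : ('I_1 -> A) -> A) (FB : ('I_1 -> B) -> B) :
  @satisfies _ A B2 FA -> @satisfies _ B B2 FB -> common_restriction FA FB ->
  idempotent_on (range i `|` range j) (@signed_le _ E 1 0 1) (fun y _ => y)
    (@glue_domain _ A B E i j 1) (@glue _ A B E i j B2 FA FB).
Proof.
move=> satA satB [FC [fFC gFC]]; split.
- exact: (glue_range imono jmono ifjg itp_ij itp_ji satA satB fFC gFC).
- exact: (glue_closed imono jmono ifjg itp_ij itp_ji satA satB fFC gFC).
- exact: (glue_homo imono jmono ifjg itp_ij itp_ji satA satB fFC gFC).
- apply: (glue_idem imono jmono ifjg itp_ij itp_ji satA satB fFC gFC).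
    by case: satA => _ /unary_idemP.
  by case: satB => _ /unary_idemP.
Qed.

Lemma extend_glue_on p (FA : ('I_(property_arity p) -> A) -> A)
    (FB : ('I_(property_arity p) -> B) -> B) x :
  satisfies FA -> satisfies FB -> common_restriction FA FB ->
  glue_domain i j x -> glued_ext FA FB x = glue i j FA FB x.
Proof.
move=> satA satB cr Xx; have [FC [fFC gFC]] := cr.
have rng := glue_range imono jmono ifjg itp_ij itp_ji satA satB fFC gFC.
have homo := glue_homo imono jmono ifjg itp_ij itp_ji satA satB fFC gFC.
have lexx := @signed_le_refl _ E.
have upper := upper_ext_on inf_spec rng homo (lexx _ _ _ x) Xx.
have lower := lower_ext_on sup_spec rng homo (lexx _ _ _ x) Xx.
clear FC fFC gFC; case: p FA FB x satA satB cr Xx rng homo upper lower => //=.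
move=> FA FB x satA satB cr Xx _ _ _ _.
apply: (idem_ext_on inf_spec sup_spec _ _ (idempotent_on_glue satA satB cr)) => //.
exact: signed_le1P.
Qed.

Lemma extend_glue_mono p (FA HA : ('I_(property_arity p) -> A) -> A)
    (FB HB : ('I_(property_arity p) -> B) -> B) x :
  satisfies FA -> satisfies FB -> common_restriction FA FB ->
  satisfies HA -> satisfies HB -> common_restriction HA HB ->
  (forall a, FA a <= HA a) -> (forall b, FB b <= HB b) ->
  glued_ext FA FB x <= glued_ext HA HB x.
Proof.
move=> FsatA FsatB Fcr HsatA HsatB Hcr FHA FHB.
have [FC [fFC gFC]] := Fcr; have [HC [fHC gHC]] := Hcr.
have Frng := glue_range imono jmono ifjg itp_ij itp_ji FsatA FsatB fFC gFC.
have Hrng := glue_range imono jmono ifjg itp_ij itp_ji HsatA HsatB fHC gHC.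
have GE := glueE imono jmono ifjg itp_ij itp_ji FsatA FsatB fFC gFC.
have HE := glueE imono jmono ifjg itp_ij itp_ji HsatA HsatB fHC gHC.
have FH u : glue_domain i j u -> glue i j FA FB u <= glue i j HA HB u.
  case=> [[a ->]|[b ->]].
    by rewrite (GE _ _ (GluedLeft _ _ _ _ a)) (HE _ _ (GluedLeft _ _ _ _ a)) imono.
  by rewrite (GE _ _ (GluedRight _ _ _ _ b)) (HE _ _ (GluedRight _ _ _ _ b)) jmono.
have FHall u : glue i j FA FB u <= glue i j HA HB u.
  have [/FH //|ndu] := pselect (glue_domain i j u).
  by rewrite !glue_default.
have upper le := upper_ext_mono inf_spec le Frng Hrng x FH.
have lower le := lower_ext_mono sup_spec le x Frng Hrng FH.
clear FC HC fFC gFC fHC gHC GE HE.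
case: p FA HA FB HB x FsatA FsatB Fcr HsatA HsatB Hcr FHA FHB Frng Hrng FH FHall
  upper lower => //=.
move=> FA HA FB HB x FsatA FsatB Fcr HsatA HsatB Hcr _ _ _ _ FH _ _ _.
apply: (idem_ext_mono inf_spec sup_spec _ _ (idempotent_on_glue FsatA FsatB Fcr)
  (idempotent_on_glue HsatA HsatB Hcr)) => //.
exact: signed_le1P.
Qed.

(** Monotonicity holds by construction. Extensivity and contractivity are inherited
    from the prescribed values through a component on which the operation is
    isotone, and idempotence then follows because these values are fixed points. *)
Lemma extend_glue_satisfies p (FA : ('I_(property_arity p) -> A) -> A)
    (FB : ('I_(property_arity p) -> B) -> B) :
  satisfies FA -> satisfies FB -> common_restriction FA FB ->
  satisfies (glued_ext FA FB).
Proof.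
move=> satA satB cr; have [FC [fFC gFC]] := cr.
have rng := glue_range imono jmono ifjg itp_ij itp_ji satA satB fFC gFC.
have closed := glue_closed imono jmono ifjg itp_ij itp_ji satA satB fFC gFC.
have idem := glue_idem imono jmono ifjg itp_ij itp_ji satA satB fFC gFC.
have dom_ind := glue_dom_ind imono jmono ifjg itp_ij itp_ji satA satB fFC gFC.
have const_ind := glue_const_ind imono jmono ifjg itp_ij itp_ji satA satB fFC gFC.
have GE := glueE imono jmono ifjg itp_ij itp_ji satA satB fFC gFC.
have glueA a := GE _ _ (GluedLeft i j FA FB (fun=> a)).
have glueB b := GE _ _ (GluedRight i j FA FB (fun=> b)).
have const_idem : (forall a, FA (fun=> FA (fun=> a)) = FA (fun=> a)) ->
    (forall b, FB (fun=> FB (fun=> b)) = FB (fun=> b)) ->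
    forall x, glue i j FA FB (fun=> glue i j FA FB (fun=> x)) =
              glue i j FA FB (fun=> x).
  move=> idemA idemB.
  apply: (const_ind (fun _ y => glue i j FA FB (fun=> y) = y)) => [a|b|] //.
    by rewrite glueA idemA.
  by rewrite glueB idemB.
have const_invol : (forall a, FA (fun=> FA (fun=> a)) = a) ->
    (forall b, FB (fun=> FB (fun=> b)) = b) ->
    forall x, glue i j FA FB (fun=> glue i j FA FB (fun=> x)) = x.
  move=> invA invB.
  apply: (const_ind (fun x y => glue i j FA FB (fun=> y) = x)) => [a|b|] //.
    by rewrite glueA invA.
  by rewrite glueB invB.
have const_ext : (forall a, a <= FA (fun=> a)) -> (forall b, b <= FB (fun=> b)) ->
    forall x, x <= glue i j FA FB (fun=> x).
  move=> extA extB.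
  by apply: (const_ind (fun x y => x <= y)) => [a|b|] //; rewrite ?imono ?jmono.
have const_con : (forall a, FA (fun=> a) <= a) -> (forall b, FB (fun=> b) <= b) ->
    forall x, glue i j FA FB (fun=> x) <= x.
  move=> conA conB.
  by apply: (const_ind (fun x y => y <= x)) => [a|b|] //; rewrite ?imono ?jmono.
have trans := @signed_le_trans _ E.
pose le := @signed_le _ E (isotone_count p) (antitone_count p) (property_arity p).
pose X := @glue_domain _ A B E i j (property_arity p).
pose G := glue i j FA FB.
have upper_homo : signed_homo (isotone_count p) (antitone_count p)
    (upper_ext inf le X G).
  move=> x y xy; apply: (upper_ext_homo inf_spec rng) => u.
  exact: trans xy.
have lower_homo : signed_homo (isotone_count p) (antitone_count p)
    (lower_ext sup le X G).
  move=> x y xy; apply: (lower_ext_homo sup_spec rng) => u ux.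
  exact: trans ux xy.
have upper_ge (k : 'I_(property_arity p)) : (k < isotone_count p)%N ->
    (forall a, a k <= FA a) -> (forall b, b k <= FB b) ->
    forall x, x k <= upper_ext inf le X G x.
  move=> kp extA extB x; apply: (upper_ext_ge inf_spec rng) => u Xu xu.
  have xuk : x k <= u k by move: (xu k); rewrite kp.
  apply: le_trans xuk _; move: u Xu {xu}.
  by apply: (dom_ind (fun u y => u k <= y)) => [a|b] /=; rewrite ?imono ?jmono.
have lower_le (k : 'I_(property_arity p)) : (k < isotone_count p)%N ->
    (forall a, FA a <= a k) -> (forall b, FB b <= b k) ->
    forall x, lower_ext sup le X G x <= x k.
  move=> kp conA conB x; apply: (lower_ext_le sup_spec rng) => u Xu ux.
  have uxk : u k <= x k by move: (ux k); rewrite kp.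
  apply: le_trans uxk; move: u Xu {ux}.
  by apply: (dom_ind (fun u y => y <= u k)) => [a|b] /=; rewrite ?imono ?jmono.
have upper_idem := upper_ext_idem inf_spec rng.
have lower_idem := lower_ext_idem sup_spec rng.
have ext1 (T : porderType d) (F : ('I_1 -> T) -> T) :
    extensive (unary F) -> forall x, x ord0 <= F x.
  by move=> extF x; rewrite [in leRHS](tuple1E x); apply: extF.
have con1 (T : porderType d) (F : ('I_1 -> T) -> T) :
    contractive (unary F) -> forall x, F x <= x ord0.
  by move=> conF x; rewrite [in leLHS](tuple1E x); apply: conF.
have le1P := @signed_le1P _ E.
rewrite {}/le {}/X {}/G in upper_homo lower_homo upper_ge lower_le.
clear FC fFC gFC trans const_ind GE glueA glueB.
case: p FA FB satA satB cr rng closed idem dom_ind const_idem const_invol const_ext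
  const_con upper_homo lower_homo upper_ge lower_le upper_idem lower_idem
  => [||||||||||||| p q n n0 pqn | p q n h n0 pqn hp] FA FB satA satB cr rng closed
     idem dom_ind const_idem const_invol const_ext const_con upper_homo lower_homo
     upper_ge lower_le upper_idem lower_idem /=;
  rewrite /= in satA satB.
(* without monotonicity, the extension is the glued operation itself *)
- exact: const_ext.
- exact: const_con.
- exact: const_idem.
- by case: satA satB => [? ?] [? ?]; split; [exact: const_idem | exact: const_ext].
- by case: satA satB => [? ?] [? ?]; split; [exact: const_idem | exact: const_con].
- exact: const_invol.
- exact/isotoneP.
- case: satA satB => [_ extA] [_ extB]; split; first exact/isotoneP.
  by move=> x; apply: (upper_ge ord0) => //; apply: ext1.
- case: satA satB => [_ conA] [_ conB]; split; first exact/isotoneP.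
  by move=> x; apply: (lower_le ord0) => //; apply: con1.
- have idG := idempotent_on_glue satA satB cr.
  have trans1 := @signed_le_trans _ E 1 0 1.
  split; last by move=> x; apply: (idem_ext_idem inf_spec sup_spec trans1 le1P idG).
  by apply/isotoneP => x y; apply: (idem_ext_homo inf_spec sup_spec trans1 le1P idG).
- case: satA satB => [_ extA idemA] [_ extB idemB].
  have extE y : y <= upper_ext inf (@signed_le _ E 1 0 1)
      (@glue_domain _ A B E i j 1) (glue i j FA FB) (fun=> y).
    by apply: (upper_ge ord0) => //; apply: ext1.
  split; [exact/isotoneP | exact: extE | move=> x /=].
  apply: (upper_idem _ (fun y _ => y)) => //.
  + by move=> y z; apply: (proj2 (le1P _ _)).
  + by apply: idem; apply: unary_idemP.
- case: satA satB => [_ conA idemA] [_ conB idemB].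
  have conE y : lower_ext sup (@signed_le _ E 1 0 1)
      (@glue_domain _ A B E i j 1) (glue i j FA FB) (fun=> y) <= y.
    by apply: (lower_le ord0) => //; apply: con1.
  split; [exact/isotoneP | exact: conE | move=> x /=].
  apply: (lower_idem _ (fun y _ => y)) => //.
  + by move=> y z; apply: (proj2 (le1P _ _)).
  + by apply: idem; apply: unary_idemP.
- exact/antitoneP.
- exact/(isotone_antitoneP _ pqn).
- split; first exact/(isotone_antitoneP _ pqn).
  move=> k x kh; apply: upper_ge; first exact: leq_trans kh hp.
    by move=> a; apply: (proj2 satA).
  by move=> b; apply: (proj2 satB).
Qed.

End ExtendGlue.

(** * Amalgamating expansions *)

Lemma superamalgamation_strong d (L : signature)
    (S : ordered_structure d L -> Prop) :
  superamalgamation S -> strong_amalgamation S.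
Proof.
move=> superS A B C f g SA SB SC emb_f emb_g.
by have [D [i [j [SD ij _]]]] := superS A B C f g SA SB SC emb_f emb_g;
  exists D, i, j.
Qed.

Lemma embedding_comp d (L : signature) (A B C : ordered_structure d L)
    (f : A -> B) (g : B -> C) :
  embedding f -> embedding g -> embedding (g \o f).
Proof.
move=> [fmono fop frel] [gmono gop grel]; split=> [x y|s x|r x] /=.
- by rewrite gmono fmono.
- by rewrite fop gop.
- by rewrite frel grel.
Qed.

Lemma embedding_reduct d (L : signature) (I : op_property -> Type)
    (A B : ordered_structure d (expand L I)) (f : A -> B) :
  embedding f -> @embedding d L (reduct A) (reduct B) f.
Proof.
by case=> fmono fop frel; split=> // s x; apply: (fop (inl s)).
Qed.

Section Expansion.
Variables (d : Order.disp_t) (L : signature) (I : op_property -> Type).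
Variables (E : ordered_structure d L)
  (F : forall p, I p -> ('I_(property_arity p) -> E) -> E).

Definition expansion : ordered_structure d (expand L I) :=
  @OrderedStructure d (expand L I) E
    (fun s : op_symbol (expand L I) =>
       match s return ('I_(@op_arity (expand L I) s) -> E) -> E with
       | inl s0 => @op d L E s0
       | inr pk => F (projT2 pk)
       end)
    (fun r => @Defs.rel d L E r).

Lemma reduct_expansion : reduct expansion = E.
Proof. by rewrite /reduct /=; case: E. Qed.

End Expansion.

Lemma interpolating_of_super d (A B C D : porderType d) (f : C -> A) (g : C -> B)
    (i : A -> D) (j : B -> D) :
  {mono i : x y / x <= y} -> {mono j : x y / x <= y} -> i \o f =1 j \o g ->
  (forall a b, ~ range f a -> ~ range g b ->
     i a <= j b -> exists c, a <= f c /\ g c <= b) ->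
  interpolating f g i j.
Proof.
move=> imono jmono ifjg super a b ab.
have [[c _ fca]|nfa] := pselect (range f a).
  by exists c; rewrite -jmono -[j (g c)]ifjg /= fca.
have [[c _ gcb]|ngb] := pselect (range g b); last exact: super.
by exists c; rewrite -imono [i (f c)]ifjg /= gcb.
Qed.

Lemma expansions_superamalgamation d (L : signature)
    (S : ordered_structure d L -> Prop) (I : op_property -> Type)
    (R : forall p, I p -> I p -> Prop) :
  superamalgamation S -> meet_join_extendible S ->
  superamalgamation (expansions S R).
Proof.
move=> superS extS A B C f g [SA satA cmpA] [SB satB cmpB] [SC _ _] emb_f emb_g.
have [D [i0 [j0 [SD [emb_i0 emb_j0 i0fj0g cap] super]]]] :=
  superS (reduct A) (reduct B) (reduct C) f g SA SB SC
    (embedding_reduct emb_f) (embedding_reduct emb_g).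
have [E [e [SE emb_e ext]]] := extS D SD.
pose i : A -> E := e \o i0; pose j : B -> E := e \o j0.
have emb_i : @embedding d L (reduct A) E i := embedding_comp emb_i0 emb_e.
have emb_j : @embedding d L (reduct B) E j := embedding_comp emb_j0 emb_e.
have [emono _ _] := emb_e.
have [imono iop irel] := emb_i; have [jmono jop jrel] := emb_j.
have ifjg : i \o f =1 j \o g by move=> c; congr e; apply: i0fj0g.
have itp_ij : interpolating f g i j.
  apply: interpolating_of_super => // a b nfa ngb; rewrite /i /j /= emono.
  by case: (super a b nfa ngb).
have itp_ji : interpolating g f j i.
  apply: interpolating_of_super => // b a ngb nfa; rewrite /i /j /= emono.
  by case: (super a b nfa ngb).
(* the images of A and B lie in D, whose subsets have meets and joins in E *)
have extU (V : set E) : V `<=` range i `|` range j ->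
    infimums V !=set0 /\ supremums V !=set0.
  move=> VU; have -> : V = e @` (e @^-1` V); last exact: ext.
  apply/seteqP; split=> [v Vv|_ [w Vw <-] //].
  by case: (VU v Vv) => -[w _ wv]; rewrite -wv in Vv *; apply: imageP.
(* [x0] is the top of E, the meet of the empty set; it is only a default value *)
have [x0 _] := proj1 (ext set0).
pose inf (V : set E) := xget x0 (infimums V).
pose sup (V : set E) := xget x0 (supremums V).
have inf_spec V : V `<=` range i `|` range j -> infimums V (inf V).
  by move=> /extU [[x xV] _]; apply: xgetI xV.
have sup_spec V : V `<=` range i `|` range j -> supremums V (sup V).
  by move=> /extU [_ [x xV]]; apply: xgetI xV.
pose F p (k : I p) :=
  extend inf sup (@glue_domain _ A B E i j _) 
    (glue i j (@new_op d L I A p k) (@new_op d L I B p k)).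
have restr p (k : I p) :
    common_restriction f g (@new_op d L I A p k) (@new_op d L I B p k).
  exists (@new_op d L I C p k).
  case: emb_f emb_g => _ fop _ [_ gop _].
  by split=> x; [exact: (fop (inr (existT I p k))) | exact: (gop (inr (existT I p k)))].
have Fi p (k : I p) a : F p k (i \o a) = i (@new_op d L I A p k a).
  rewrite /F (extend_glue_on imono jmono ifjg itp_ij itp_ji) //; last first.
    by left; exists a.
  have [FC [fFC gFC]] := restr p k.
  exact: (glueE imono jmono ifjg itp_ij itp_ji (satA p k) (satB p k) fFC gFC
    (GluedLeft _ _ _ _ _)).
have Fj p (k : I p) b : F p k (j \o b) = j (@new_op d L I B p k b).
  rewrite /F (extend_glue_on imono jmono ifjg itp_ij itp_ji) //; last first.
    by right; exists b.
  have [FC [fFC gFC]] := restr p k.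
  exact: (glueE imono jmono ifjg itp_ij itp_ji (satA p k) (satB p k) fFC gFC
    (GluedRight _ _ _ _ _)).
exists (expansion F), i, j; split.
- split=> [|p k|p h k Rhk x].
  + by rewrite reduct_expansion.
  + exact: (extend_glue_satisfies imono jmono ifjg itp_ij itp_ji inf_spec sup_spec).
  + apply: (extend_glue_mono imono jmono ifjg itp_ij itp_ji inf_spec sup_spec) => //.
      exact: cmpA.
    exact: cmpB.
- split=> //.
  + by split=> // -[s|[p k]] x; [apply: (iop s) | rewrite -Fi].
  + by split=> // -[s|[p k]] x; [apply: (jop s) | rewrite -Fj].
  + have einj := inc_inj emono.
    apply/seteqP; split=> [z [[a _ az] [b _ bz]]|z [c _ <-]]; last first.
      by split; [exists (f c) | exists (g c) => //; rewrite -[RHS]ifjg].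
    have : range (i0 \o f) (i0 a).
      rewrite -cap; split; first exact: imageP.
      by exists b => //; apply: einj; rewrite -[LHS]/(j b) bz -az.
    by case=> c _ ca; exists c => //; rewrite -az /i /= -ca.
- move=> a b nfa ngb; rewrite /i /j /= !emono; exact: super.
Qed.

Theorem theorem4p1 (d : Order.disp_t) (L : signature)
    (S : ordered_structure d L -> Prop)
    (S_iso : isomorphism_closed S)
    (S_super : superamalgamation S) :
  (completely_extendible S -> meet_join_extendible S) /\
  (meet_join_extendible S ->
     (forall p : op_property,
        superamalgamation (expansions S (@no_comparability (sole p))) /\
        strong_amalgamation (expansions S (@no_comparability (sole p)))) /\
     (forall (I : op_property -> Type) (R : forall p, I p -> I p -> Prop),
        superamalgamation (expansions S R) /\
        strong_amalgamation (expansions S R))).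
Proof.
have both I (R : forall p, I p -> I p -> Prop) : meet_join_extendible S ->
    superamalgamation (expansions S R) /\ strong_amalgamation (expansions S R).
  move=> extS; have super := @expansions_superamalgamation d L S I R S_super extS.
  by split=> //; apply: superamalgamation_strong.
split=> [complS F SF|extS]; last by split=> [p|I R]; apply: both.
have [E [e [SE emb_e complE]]] := complS F SF.
by exists E, e; split=> // X; apply: complE.
Qed.
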